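(* Let $\mathcal{A},\mathcal{B}$ be unital $C^*$-algebras and $k\ge 1$. If $\varphi:\mathcal{A}^k\to\mathcal{B}$ is an invariant positive $k$-linear map, then $\varphi$ is symmetric, that is, $\varphi^*=\varphi$.
   Context: Let $m=\lfloor (k+1)/2\rfloor$ (so $k=2m-1$ or $k=2m$), and $\mathcal{A}^k=\mathcal{A}\times\cdots\times\mathcal{A}$ ($k$ times). A $k$-linear map $\varphi:\mathcal{A}^k\to\mathcal{B}$ is positive if $\varphi(a_1,\ldots,a_k)\ge 0$ whenever $(a_1,a_2,\ldots,a_k)=(a_k^*,a_{k-1}^*,\ldots,a_1^* )$, with the additional assumption $a_m\ge 0$ when $k$ is odd. A $k$-linear map $\varphi:\mathcal{A}^k\to\mathcal{B}$ is invariant if: when $k=2m-1$, $\varphi(a_1c_1,\ldots,a_{m-1}c_{m-1},a_m,a_{m+1},\ldots,a_{2m-1})=\varphi(a_1,\ldots,a_{m-1},a_m,c_{m-1}a_{m+1},\ldots,c_1a_{2m-1})$ for all $a_1,\ldots,a_{2m-1},c_1,\ldots,c_{m-1}\in\mathcal{A}$; when $k=2m$, $\varphi(a_1c_1,\ldots,a_mc_m,a_{m+1},\ldots,a_{2m})=\varphi(a_1,\ldots,a_m,c_ma_{m+1},\ldots,c_1a_{2m})$ for all $a_1,\ldots,a_{2m},c_1,\ldots,c_m\in\mathcal{A}$. The adjoint of a $k$-linear map $\varphi:\mathcal{A}^k\to\mathcal{B}$ is the $k$-linear map $\varphi^*(a_1,a_2,\ldots,a_k):=\varphi(a_k^*,\ldots,a_2^*,a_1^*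 )^*$. *)

(* Defs.v *)
From HB Require Import structures.
From mathcomp Require Import all_boot all_order all_algebra.
From mathcomp Require Import complex.
From mathcomp Require Import all_classical all_reals all_analysis.
Import Order.TTheory GRing.Theory Num.Theory.
Import numFieldNormedType.Exports.

Set Implicit Arguments.
Unset Strict Implicit.
Unset Printing Implicit Defensive.

Local Open Scope ring_scope.

(* Unital C*-algebras over R[i]: the order of R[i] is partial (0 <= z means that
   z is a nonnegative real), and norms take their values in R[i].
   Hierarchy-Builder admits no join of the normed modules with the rings, so the
   multiplication is given here; the ring structure is derived from it below.
   The zero algebra is not excluded. *)
HB.mixin Record isCStarAlgebra (R : realType) A
    & CompleteNormedModule R[i] A := {
  cstar_one : A;
  cstar_mul : A -> A -> A;
  star : A -> A;
  cstar_mulA : associative cstar_mul;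
  cstar_mul1l : left_id cstar_one cstar_mul;
  cstar_mul1r : right_id cstar_one cstar_mul;
  cstar_mulDl : left_distributive cstar_mul +%R;
  cstar_mulDr : right_distributive cstar_mul +%R;
  cstar_scaleAl : forall (z : R[i]) (a b : A),
    z *: cstar_mul a b = cstar_mul (z *: a) b;
  cstar_scaleAr : forall (z : R[i]) (a b : A),
    z *: cstar_mul a b = cstar_mul a (z *: b);
  cstar_normM : forall a b : A, `|cstar_mul a b| <= `|a| * `|b|;
  starK : involutive star;
  starD : {morph star : a b / a + b};
  starZ : forall (z : R[i]) (a : A), star (z *: a) = z^*%C *: star a;
  starM : forall a b : A, star (cstar_mul a b) = cstar_mul (star b) (star a);
  cstar_identity : forall a : A, `|cstar_mul (star a) a| = `|a| ^+ 2
}.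

#[short(type="cstarAlgType")]
HB.structure Definition CStarAlgebra (R : realType) :=
  {A of CompleteNormedModule R[i] A & isCStarAlgebra R A}.

HB.instance Definition _ (R : realType) (A : cstarAlgType R) :=
  GRing.Zmodule_isPzRing.Build (CStarAlgebra.sort A)
    (@cstar_mulA R A) (@cstar_mul1l R A) (@cstar_mul1r R A)
    (@cstar_mulDl R A) (@cstar_mulDr R A).

Section CStarElements.
Context {R : realType} {A : cstarAlgType R}.

Definition invertible (a : A) : Prop := exists b : A, a * b = 1 /\ b * a = 1.

Definition spectrum (a : A) : set R[i] :=
  [set z : R[i] | ~ invertible (z *: (1 : A) - a)].

Definition positive_elt (a : A) : Prop :=
  star a = a /\ forall z : R[i], spectrum a z -> 0 <= z.

End CStarElements.

(* A k-tuple (a_1, ..., a_k) is a function a : 'I_k -> A with a_j = a (j - 1);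
   [rev_ord] then exchanges the (1-based) positions j and k + 1 - j. *)
Section MultilinearMaps.
Context {R : realType} {A B : cstarAlgType R} {k : nat}.
Implicit Type phi : ('I_k -> A) -> B.

Definition multilinear phi : Prop :=
  forall (i : 'I_k) (a : 'I_k -> A), linear (fun x : A => phi (dfwith a i x)).

(* For odd k = 2m - 1, the middle position m is the index k./2 = m - 1. *)
Definition positive_map phi : Prop :=
  forall a : 'I_k -> A,
    (forall i, a i = star (a (rev_ord i))) ->
    (odd k -> forall i : 'I_k, i = k./2 :> nat -> positive_elt (a i)) ->
    positive_elt (phi a).

(* With h = k./2, that is h = m - 1 if k = 2m - 1 and h = m if k = 2m, both
   cases of the definition read
     phi (a_1 c_1, ..., a_h c_h, a_(h+1), ..., a_k)
       = phi (a_1, ..., a_(k-h), c_h a_(k-h+1), ..., c_1 a_k).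
   Only the values c i with i < h are used. *)
Definition invariant_map phi : Prop :=
  forall a c : 'I_k -> A,
    phi (fun i => if (i < k./2)%N then a i * c i else a i) =
    phi (fun i => if (rev_ord i < k./2)%N then c (rev_ord i) * a i else a i).

Definition adjoint_map phi : ('I_k -> A) -> B :=
  fun a => star (phi (fun i => star (a (rev_ord i)))).

Definition symmetric_map phi : Prop := adjoint_map phi = phi.

End MultilinearMaps.

(* Main.v *)
(* Invariance gives [phi a = phi (1, ..., 1, a_m, c_h, ..., c_1)], where
   [c_j = a_j * a_(k+1-j)] and the middle entry [a_m] occurs only for odd [k],
   and likewise for the adjoint of [phi]. By multilinearity it suffices to
   compare the two maps when the [c_j] have the form [y * star y] and [a_m] is
   positive, since such elements span the algebra; then both values are the value
   of [phi] at a hermitian tuple and its adjoint. That the positive elements span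
   rests on [a + `|a|] being positive for self-adjoint [a]. *)
Require Import Defs.
From mathcomp Require Import all_boot all_order all_algebra.
From mathcomp Require Import complex ring lra zify.
From mathcomp Require Import all_classical all_reals all_analysis.
Import Order.TTheory GRing.Theory Num.Theory.
Import numFieldNormedType.Exports.

Set Implicit Arguments.
Unset Strict Implicit.
Unset Printing Implicit Defensive.

Local Open Scope ring_scope.
Local Open Scope complex_scope.

(** * Neumann series, spectra of self-adjoint elements, and positivity of shifts *)

Section CStarTheory.
Context {R : realType} {A : cstarAlgType R}.
Implicit Types (a b : A) (z w : R[i]).

Lemma cstar_scalerAl z a b : z *: (a * b) = (z *: a) * b.
Proof. exact: cstar_scaleAl. Qed.

Lemma cstar_scalerAr z a b : z *: (a * b) = a * (z *: b).
Proof. exact: cstar_scaleAr. Qed.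

Lemma starMr a b : star (a * b) = star b * star a.
Proof. exact: starM. Qed.

Lemma star0 : star (0 : A) = 0.
Proof. by rewrite -[X in star X](scale0r (0 : A)) starZ rmorph0 scale0r. Qed.

Lemma starN a : star (- a) = - star a.
Proof. by rewrite -scaleN1r starZ rmorphN rmorph1 scaleN1r. Qed.

Lemma star1 : star (1 : A) = 1.
Proof.
by rewrite -[LHS]mulr1 -{2}[1 : A](@starK R A) -starMr mulr1 starK.
Qed.

Lemma cstar_norm_mul a b : `|a * b| <= `|a| * `|b|.
Proof. exact: cstar_normM. Qed.

Lemma norm_starM a : `|star a * a| = `|a| ^+ 2.
Proof. exact: cstar_identity. Qed.

(** The C*-identity at 1 makes the norm of 1 idempotent, hence 0 or 1; the value 0 occurs in the
    zero algebra. *)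
Lemma cstar_norm1_le1 : `|1 : A| <= 1.
Proof.
have := norm_starM 1; rewrite star1 mulr1 => /esym/eqP.
rewrite expr2 -subr_eq0 -{3}[`|1 : A|]mulr1 -mulrBr mulf_eq0 subr_eq0.
by case/orP => /eqP ->.
Qed.

Lemma cstar_norm_expM a b n : `|a ^+ n * b| <= `|a| ^+ n * `|b|.
Proof.
elim: n => [|n IHn]; first by rewrite !expr0 !mul1r.
rewrite !exprS -!mulrA (le_trans (cstar_norm_mul _ _))//.
exact: ler_wpM2l.
Qed.

Lemma exp_lt_eventually z : 0 <= z -> z < 1 ->
  forall e, 0 < e -> exists n, z ^+ n < e.
Proof.
case: z => x y; rewrite lecE ltcE /= => /andP[/eqP-> x0] /andP[_ x1].
case=> e f; rewrite ltcE /= => /andP[/eqP-> e0].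
have x1' : `|x| < 1 by rewrite ger0_norm.
have /cvgrPdist_lt cx := cvg_expr x1'.
have [n _ /(_ n (leqnn n)) /=] := cx _ e0.
rewrite sub0r normrN => xne; exists n.
by rewrite !complexr0 -rmorphXn ltcR (le_lt_trans (ler_norm _) xne).
Qed.

(** The bound is the fixed point of [s |-> 1 + r * s], with [r] the norm of [b], and each further
    term of the sum applies at most this map. *)
Lemma geom_norm_le b n : `|b| < 1 ->
  `|\sum_(i < n) b ^+ i| <= (1 - `|b|)^-1.
Proof.
move=> b1; have b1' : 0 < 1 - `|b| by rewrite subr_gt0.
elim: n => [|n IHn]; first by rewrite big_ord0 normr0 invr_ge0 ltW.
rewrite big_ord_recl expr0.
under eq_bigr do rewrite exprS.
rewrite -mulr_sumr (le_trans (ler_normD _ _))//.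
rewrite (_ : (1 - `|b|)^-1 = 1 + `|b| * (1 - `|b|)^-1); last first.
  by field; rewrite gt_eqF.
apply: lerD; first exact: cstar_norm1_le1.
by apply: le_trans (cstar_norm_mul _ _) _; apply: ler_wpM2l.
Qed.

Lemma geom_cvg b : `|b| < 1 ->
  cvg ((fun n => \sum_(i < n) b ^+ i : A) @ \oo)%classic.
Proof.
move=> b1; have b1' : 0 < 1 - `|b| by rewrite subr_gt0.
apply/cauchy_cvgP/cauchy_exP => e e0.
have [|n bn] := exp_lt_eventually (normr_ge0 b) b1 (e := e * (1 - `|b|)).
  exact: mulr_gt0.
exists (\sum_(i < n) b ^+ i : A); exists n => // m /= nm.
(* The difference of two partial sums is [b ^+ n] times another partial sum. *)
rewrite -ball_normE /= distrC -(subnKC nm) big_split_ord /= addrAC subrr add0r.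
under eq_bigr do rewrite exprD.
rewrite -mulr_sumr (le_lt_trans (cstar_norm_expM _ _ _))//.
apply: le_lt_trans (_ : `|b| ^+ n * (1 - `|b|)^-1 < _); last first.
  by rewrite ltr_pdivrMr.
by rewrite ler_wpM2l ?exprn_ge0// geom_norm_le.
Qed.

(** The partial sums are iterates of the contraction [f], so their limit is fixed by it. Taking
    [f x] to be [1 + b * x] or [1 + x * b] gives the two sides of the Neumann inverse. *)
Lemma cvg_geom_fixed b (f : A -> A) (y : A) :
  (forall x x', `|f x - f x'| <= `|b| * `|x - x'|) -> `|b| < 1 ->
  (forall n, \sum_(i < n.+1) b ^+ i = f (\sum_(i < n) b ^+ i)) ->
  ((\sum_(i < n) b ^+ i : A) @[n --> \oo] --> y)%classic -> f y = y.
Proof.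
move=> lipf b1 sf /cvgrPdist_lt cy.
apply/eqP; rewrite -subr_eq0 -normr_eq0; apply/negPn/negP => fy.
have e0 : 0 < `|f y - y| / 2 by rewrite divr_gt0// lt_neqAle eq_sym fy/=.
have [n _ ny] := cy _ e0.
have := ler_distD (f (\sum_(i < n) b ^+ i)) (f y) y.
rewrite lt_geF// [ltRHS](splitr `|f y - y|) ltrD//.
  apply: le_lt_trans (ny n (leqnn n)); apply: le_trans (lipf _ _) _.
  by rewrite ler_piMl// ltW.
by rewrite distrC -sf; exact: ny n.+1 (leqnSn n).
Qed.

Lemma invertible_1sub b : `|b| < 1 -> invertible (1 - b).
Proof.
move=> b1; have /cvg_ex[y cy] := geom_cvg b1; exists y; split.
- have /eqP : 1 + b * y = y.
    apply: (@cvg_geom_fixed b (fun x => 1 + b * x) y _ b1 _ cy).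
      move=> x x'; rewrite opprD addrACA subrr add0r -mulrBr.
      exact: cstar_norm_mul.
    move=> n; rewrite big_ord_recl expr0 mulr_sumr.
    by under eq_bigr do rewrite exprS.
  by rewrite mulrBl mul1r eq_sym -subr_eq => /eqP.
- have /eqP : 1 + y * b = y.
    apply: (@cvg_geom_fixed b (fun x => 1 + x * b) y _ b1 _ cy).
      move=> x x'; rewrite opprD addrACA subrr add0r -mulrBl mulrC.
      exact: cstar_norm_mul.
    move=> n; rewrite big_ord_recl expr0 mulr_suml.
    by under eq_bigr do rewrite exprSr.
  by rewrite mulrBr mulr1 eq_sym -subr_eq => /eqP.
Qed.

Lemma spectrum_norm_le a z : spectrum a z -> `|z| <= `|a|.
Proof.
move=> az; rewrite real_leNgt ?normr_real//; apply/negP => ltaz; apply: az.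
have z0 : z != 0 by rewrite -normr_gt0 (le_lt_trans _ ltaz).
have [|y [y1 y2]] := @invertible_1sub (z^-1 *: a).
  by rewrite normrZ normrV ?unitfE// mulrC ltr_pdivrMr ?normr_gt0// mul1r.
(* Factoring out [z] leaves a perturbation of 1 of norm less than 1. *)
have -> : z *: (1 : A) - a = z *: (1 - z^-1 *: a).
  by rewrite scalerBr scalerA mulfV// scale1r.
exists (z^-1 *: y); split.
  by rewrite -cstar_scalerAl -cstar_scalerAr scalerA mulfV// scale1r.
by rewrite -cstar_scalerAl -cstar_scalerAr scalerA mulVf// scale1r.
Qed.

Lemma spectrumD a z w : spectrum (a + w *: (1 : A)) z -> spectrum a (z - w).
Proof. by rewrite /spectrum /= scalerBl opprD addrA addrAC. Qed.

Lemma selfadj_shift_norm a (t : R) : star a = a ->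
  `|a + (0 +i* t) *: (1 : A)| ^+ 2 <= `|a| ^+ 2 + (t ^+ 2)%:C.
Proof.
move=> sa; rewrite -norm_starM starD starZ star1 sa.
(* As [i t] is anti-self-adjoint, the cross terms of the product cancel. *)
have -> : (0 +i* t)^* = - (0 +i* t) by apply/eqP; rewrite eq_complex /= oppr0 !eqxx.
have -> : (a + - (0 +i* t) *: (1 : A)) * (a + (0 +i* t) *: (1 : A))
    = a * a + (t ^+ 2)%:C *: (1 : A).
  rewrite mulrDl !mulrDr -!cstar_scalerAl -!cstar_scalerAr !mul1r !mulr1.
  rewrite !scalerA addrA -[a * a + _ + _]addrA scaleNr subrr addr0; congr (_ + _ *: _).
  by apply/eqP; rewrite eq_complex /=; apply/andP; split; apply/eqP; ring.
rewrite (le_trans (ler_normD _ _))// lerD ?expr2 ?cstar_norm_mul//.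
rewrite normrZ ger0_norm; last by rewrite ler0c -expr2 sqr_ge0.
by rewrite ler_piMr ?cstar_norm1_le1// ler0c -expr2 sqr_ge0.
Qed.

(* Arens' argument: adding [i t] to [a] moves the spectrum along by [i t], but
   the square of the norm grows only by [t ^+ 2]. *)
Lemma selfadj_spectrum_ge a z : star a = a -> spectrum a z -> - `|a| <= z.
Proof.
move=> sa az; have az_t (t : R) : (complex.Re z) ^+ 2 + (complex.Im z + t) ^+ 2 <=
    (complex.Re `|a|) ^+ 2 + t ^+ 2.
  have /spectrum_norm_le : spectrum (a + (0 +i* t) *: (1 : A)) (z + (0 +i* t)).
    by rewrite /spectrum /= scalerDl opprD addrACA subrr addr0.
  rewrite -lecR => zt; have na : (complex.Re `|a|)%:C = `|a| by rewrite RRe_real.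
  rewrite [leRHS]rmorphD rmorphXn /= na.
  apply: le_trans (selfadj_shift_norm t sa).
  apply: le_trans (_ : `|z + (0 +i* t)| ^+ 2 <= _).
    by rewrite -add_Re2_Im2; case: (z) => x y /=; rewrite addr0.
  by rewrite ler_pXn2r ?nnegrE.
have z0 : complex.Im z = 0.
  apply/eqP/negPn/negP => yz.
  (* In [az_t] the squares of [t] cancel; this [t] makes the cross term equal to the squared norm of
     [a], which leaves the sum of the squares of both parts of [z] at most 0. *)
  set t := complex.Re `|a| ^+ 2 / (2 * complex.Im z).
  have tz : 2 * complex.Im z * t = complex.Re `|a| ^+ 2.
    by rewrite /t mulrC mulfVK// mulf_neq0// pnatr_eq0.
  have := az_t t; have : 0 < complex.Im z ^+ 2 by rewrite exprn_even_gt0.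
  have := sqr_ge0 (complex.Re z); nra.
have := az_t 0; rewrite z0 !(addr0, add0r) expr0n /= !addr0 => zn.
move: zn z0 (normr_ge0 a); case: `|a| => n m; rewrite !lecE /=.
case: z {az az_t} => x y /= zn -> /andP[/eqP -> n0].
rewrite oppr0 eqxx /=.
rewrite lerNl (le_trans (ler_norm _))// normrN -ler_sqr ?nnegrE//.
by rewrite real_normK ?num_real.
Qed.

Lemma positive_elt_shift a z : star a = a -> `|a| <= z ->
  positive_elt (a + z *: (1 : A)).
Proof.
move=> sa az; have z_ge0 : 0 <= z := le_trans (normr_ge0 a) az.
(* Since [z] dominates a norm it is real, so conjugation fixes it. *)
split; first by rewrite starD starZ star1 sa -[in LHS](ger0_norm z_ge0) normc_def
  conjc_real -normc_def ger0_norm.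
move=> w /spectrumD /(selfadj_spectrum_ge sa); rewrite lerBrDr; apply: le_trans.
by rewrite addrC subr_ge0.
Qed.

End CStarTheory.

(** * Linear spans and spanning families of a C*-algebra *)

(** The combinations have the shape [c *: x + y] used by [linear], so that induction on the span
    meets multilinearity directly. *)
Inductive lin_span (K : pzRingType) (V : lmodType K) (S : V -> Prop) : V -> Prop :=
| lin_span_gen x : S x -> lin_span S x
| lin_span_comb (c : K) x y :
    lin_span S x -> lin_span S y -> lin_span S (c *: x + y).

Section LinSpan.
Context {K : pzRingType} {V : lmodType K}.
Implicit Type S : V -> Prop.

Lemma lin_spanB S x y : lin_span S x -> lin_span S y -> lin_span S (x - y).
Proof. by move=> Sx Sy; rewrite addrC -scaleN1r; exact: lin_span_comb. Qed.

Lemma lin_spanZ S (c : K) x : lin_span S x -> lin_span S (c *: x).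
Proof.
(* No constructor yields 0, so it is obtained as [x - x]. *)
move=> Sx; rewrite -[_ *: _]addr0 -(subrr x).
by apply: lin_span_comb => //; exact: lin_spanB.
Qed.

Lemma lin_span_trans S S' x : (forall y, S y -> lin_span S' y) ->
  lin_span S x -> lin_span S' x.
Proof. by move=> SS'; elim=> [y /SS'//|c y z _ ? _ ?]; exact: lin_span_comb. Qed.

End LinSpan.

Section CStarSpan.
Context {R : realType} {A : cstarAlgType R}.

Lemma lin_span_selfadj (a : A) : lin_span (fun x : A => star x = x) a.
Proof.
(* Real and imaginary parts: the inner factor ['i] makes [star a - a] self-adjoint. *)
have -> : a = 2^-1 *: (a + star a) + (2^-1 * 'i) *: ('i *: (star a - a)).
  rewrite scalerA -mulrA -expr2 sqr_i mulrN1 scaleNr -scalerN opprB -scalerDr.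
  rewrite addrACA subrr addr0 -mulr2n -[a *+ 2]scaler_nat scalerA mulVf ?scale1r//.
apply: lin_span_comb.
  by apply: lin_span_gen; rewrite starD starK addrC.
apply: lin_spanZ; apply: lin_span_gen.
rewrite starZ starD starN starK.
have -> : 'i^* = - 'i :> R[i] by apply/eqP; rewrite eq_complex /= oppr0 !eqxx.
by rewrite scaleNr -scalerN opprB.
Qed.

Lemma lin_span_positive (a : A) : lin_span positive_elt a.
Proof.
apply: lin_span_trans (lin_span_selfadj a) => {}a sa.
rewrite -[a](addrK (`|a| *: (1 : A))); apply: lin_spanB; apply: lin_span_gen.
  exact: positive_elt_shift.
rewrite -[_ *: _]add0r; apply: positive_elt_shift; first exact: star0.
by rewrite normr0.
Qed.

Lemma lin_span_mulr_star (a : A) :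
  lin_span (fun x : A => exists y, x = y * star y) a.
Proof.
apply: lin_span_trans (lin_span_selfadj a) => {}a sa.
(* Polarisation against 1: for self-adjoint [a], both squares have the form [y * star y]. *)
have -> : a = 4^-1 *: ((a + 1) * (a + 1) - (a - 1) * (a - 1)).
  have -> : (a + 1) * (a + 1) = a * a + 1 + (a + a).
    by rewrite mulrDl !mulrDr !mul1r !mulr1 [X in _ + X]addrC addrACA.
  have -> : (a - 1) * (a - 1) = a * a + 1 - (a + a).
    rewrite mulrDl !mulrDr !mulrN !mulNr !mul1r !mulr1 opprK opprD.
    by rewrite [X in _ + X]addrC addrACA.
  rewrite opprB [X in _ *: X]addrC addrA subrK -(mulr2n a) -mulrnDr.
  by rewrite -[a *+ _]scaler_nat scalerA mulVf ?scale1r// pnatr_eq0.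
apply: lin_spanZ; apply: lin_spanB; apply: lin_span_gen.
  by exists (a + 1); rewrite starD star1 sa.
by exists (a - 1); rewrite starD starN star1 sa.
Qed.

End CStarSpan.

(** * Multilinear maps, their adjoints, and agreement on spanning sets *)

Section Multilinear.
Context {R : realType} {A B : cstarAlgType R} {k : nat}.
Implicit Types phi psi : ('I_k -> A) -> B.

(** The star on the entry and the star on the value each conjugate the scalar, so the two
    conjugations cancel. *)
Lemma adjoint_map_multilinear phi :
  multilinear phi -> multilinear (adjoint_map phi).
Proof.
move=> mphi i a c x y; rewrite /adjoint_map.
have dfE z : (fun j => star (dfwith a i z (rev_ord j))) =
    dfwith (fun j => star (a (rev_ord j))) (rev_ord i) (star z).
  apply/funext => j; have [<-|ij] := eqVneq (rev_ord i) j.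
    by rewrite dfwithin rev_ordK dfwithin.
  by rewrite !dfwithout// -(inj_eq rev_ord_inj) rev_ordK.
by rewrite !dfE starD starZ mphi starD starZ conjcK.
Qed.

Lemma eq_multilinear_lin_span (S : 'I_k -> A -> Prop) phi psi :
    multilinear phi -> multilinear psi ->
    (forall a, (forall i, S i (a i)) -> phi a = psi a) ->
  forall a, (forall i, lin_span (S i) (a i)) -> phi a = psi a.
Proof.
move=> mphi mpsi eqS a Sa.
(* Coordinates pass from generators to spans one at a time: the first [n] entries lie in the spans,
   the others are still generators. *)
suff eqn n : (n <= k)%N -> forall b, (forall i : 'I_k,
    if (i < n)%N then lin_span (S i) (b i) else S i (b i)) -> phi b = psi b.
  by apply: (eqn k (leqnn k)) => i; rewrite ltn_ord.
elim: n => [_ b Sb|n IHn nk b Sb]; first exact: eqS.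
pose i := Ordinal nk.
have bE : b = dfwith b i (b i).
  apply/funext => j; have [<-|ij] := eqVneq i j; first by rewrite dfwithin.
  by rewrite dfwithout.
have := Sb i; rewrite ltnSn bE dfwithin; elim=> [x Sx|c x y _ xE _ yE].
  apply: IHn (ltnW nk) _ _ => j; have [<-|ij] := eqVneq i j.
    by rewrite ltnn dfwithin.
  have jn : val j != n by apply: contraNneq ij => jn; apply/eqP/val_inj.
  rewrite dfwithout//; have := Sb j.
  by rewrite ltnS leq_eqVlt (negbTE jn).
by rewrite mphi mpsi xE yE.
Qed.

End Multilinear.

(** * Normal forms of tuples under an invariant map *)

Section Invariant.
Context {R : realType} {A B : cstarAlgType R} {k : nat}.
Implicit Types (phi : ('I_k -> A) -> B) (i : 'I_k).

Lemma rev_ord_lt_halfF i : (i < k./2)%N -> (rev_ord i < k./2)%N = false.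
Proof. by move=> /=; have := ltn_ord i; lia. Qed.

Lemma rev_ord_half i : (i < k./2)%N = false -> (rev_ord i < k./2)%N = false ->
  rev_ord i = i.
Proof. by move=> /= il ir; apply/val_inj => /=; have := ltn_ord i; lia. Qed.

(** The last branch is reached only at the middle index of an odd [k]. *)
Definition right_form (a : 'I_k -> A) : 'I_k -> A := fun i =>
  if (i < k./2)%N then 1
  else if (rev_ord i < k./2)%N then a (rev_ord i) * a i else a i.

Lemma invariant_right_form phi a : invariant_map phi ->
  phi (right_form a) = phi a.
Proof.
move=> /(_ (fun i => if (i < k./2)%N then 1 else a i) a) iphi.
transitivity (phi (fun i => if (rev_ord i < k./2)%N
    then a (rev_ord i) * (if (i < k./2)%N then 1 else a i)
    else if (i < k./2)%N then 1 else a i)).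
  congr phi; apply/funext => i; rewrite /right_form.
  by case: ifPn => // /rev_ord_lt_halfF ->.
rewrite -iphi; congr phi; apply/funext => i.
by case: ifPn => [->|/negbTE ->]; rewrite ?mul1r.
Qed.

(** Reversal puts the starred products [star (a (rev_ord i)) * star (a i)] in the left half;
    invariance carries the right factor [star (a i)] back to the mirror position, where the entry is
    1. *)
Lemma invariant_adjoint_right_form phi a : invariant_map phi ->
  adjoint_map phi (right_form a) = adjoint_map phi a.
Proof.
move=> /(_ (fun i => if (rev_ord i < k./2)%N then 1 else star (a (rev_ord i)))
  (fun i => star (a i))) iphi.
congr star; etransitivity; first etransitivity; [|exact: iphi|].
  congr phi; apply/funext => i; rewrite /right_form rev_ordK.
  have [il|_] := boolP (i < k./2)%N; first by rewrite rev_ord_lt_halfF// starMr.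
  by case: ifPn; rewrite ?star1.
congr phi; apply/funext => i.
by case: (boolP (rev_ord i < k./2)%N); rewrite ?mulr1.
Qed.

(** Generators chosen position by position so that their spans contain the entries of every
    [right_form]. *)
Definition square_form i (x : A) : Prop :=
  if (i < k./2)%N then x = 1
  else if (rev_ord i < k./2)%N then exists y, x = y * star y
  else positive_elt x.

(* Invariance moves the factors [y i] of [a i = y i * star (y i)] to the left
   half, both in [phi a] and in the adjoint, giving the same hermitian tuple. *)
Lemma adjoint_map_square_form phi a : invariant_map phi -> positive_map phi ->
  (forall i, square_form i (a i)) -> adjoint_map phi a = phi a.
Proof.
move=> iphi pphi Sa.
have /choice[y yE] : forall i, exists y,
    ~~ (i < k./2)%N -> (rev_ord i < k./2)%N -> a i = y * star y.
  move=> i; have := Sa i; rewrite /square_form.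
  by case: ifPn => // _; [exists 0|case: ifPn => [_ [y ->]|]; [exists y|exists 0]].
have a_left i : (i < k./2)%N -> a i = 1.
  by move=> il; have := Sa i; rewrite /square_form il.
have a_right i : (i < k./2)%N = false -> (rev_ord i < k./2)%N ->
    a i = y i * star (y i) by move=> /negbT; exact: yE.
have a_mid i : (i < k./2)%N = false -> (rev_ord i < k./2)%N = false ->
    positive_elt (a i).
  by move=> il ir; have := Sa i; rewrite /square_form il ir.
(* Each square on the right is split: its factor [y] sits at the mirror position, its factor
   [star y] stays. This makes [h] hermitian, so [phi h] is positive and in particular
   self-adjoint. *)
pose h i : A := if (i < k./2)%N then y (rev_ord i)
  else if (rev_ord i < k./2)%N then star (y i) else a i.
have phih : star (phi h) = phi h.
  apply: (pphi h _ _).1 => [i|kodd i ik]; rewrite /h ?rev_ordK.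
    case: ifPn => [il|/negbTE il]; first by rewrite rev_ord_lt_halfF// starK.
    case: ifPn => // /negbTE ir; rewrite rev_ord_half//.
    by rewrite (a_mid i il ir).1.
  have il : (i < k./2)%N = false by rewrite ik ltnn.
  have ir : (rev_ord i < k./2)%N = false by move=> /=; lia.
  by rewrite il ir; exact: a_mid.
(* Invariance read from right to left: the factors [y] leave the right half and meet the ones on the
   left. *)
have -> : phi a = phi h.
  etransitivity; last etransitivity; [|exact: esym (iphi (fun i =>
    if (i < k./2)%N then 1 else h i) (fun i => y (rev_ord i)))|].
    congr phi; apply/funext => i; rewrite rev_ordK /h.
    have [il|/negbTE il] := boolP (i < k./2)%N.
      by rewrite rev_ord_lt_halfF ?a_left.
    by have [ir|//] := boolP (rev_ord i < k./2)%N; exact: a_right.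
  congr phi; apply/funext => i; rewrite /h.
  by case: (boolP (i < k./2)%N); rewrite ?mul1r.
(* In the reversed starred tuple the squares, being self-adjoint, stand unchanged in the left half;
   invariance read from left to right sends their factors [star y] to the right, giving [h]
   again. *)
rewrite -[RHS]phih; congr star.
etransitivity; first etransitivity; [|exact: iphi (fun i =>
    if (rev_ord i < k./2)%N then 1 else h i) (fun i => star (y (rev_ord i)))|].
  congr phi; apply/funext => i; rewrite /h.
  have [il|/negbTE il] := boolP (i < k./2)%N.
    by rewrite rev_ord_lt_halfF// a_right ?rev_ordK ?rev_ord_lt_halfF//
      starMr starK.
  have [ir|/negbTE ir] := boolP (rev_ord i < k./2)%N; first by rewrite a_left// star1.
  by rewrite rev_ord_half// (a_mid i il ir).1.
congr phi; apply/funext => i; rewrite rev_ordK /h.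
have [il|_] := boolP (i < k./2)%N; first by rewrite rev_ord_lt_halfF.
by case: (boolP (rev_ord i < k./2)%N); rewrite ?mulr1.
Qed.

Lemma lin_span_right_form a i : lin_span (square_form i) (right_form a i).
Proof.
rewrite /right_form /square_form; case: ifPn => _; first exact: lin_span_gen.
by case: ifPn => _; [exact: lin_span_mulr_star|exact: lin_span_positive].
Qed.

End Invariant.

Theorem proposition2p4 (R : realType) (A B : cstarAlgType R) (k : nat)
    (hk : (1 <= k)%N) (phi : ('I_k -> A) -> B) :
  multilinear phi -> invariant_map phi -> positive_map phi ->
  symmetric_map phi.
Proof.
move=> mphi iphi pphi; apply/funext => a.
rewrite -invariant_adjoint_right_form// -[RHS]invariant_right_form//.
apply: (eq_multilinear_lin_span (adjoint_map_multilinear mphi) mphi).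
  by move=> b; exact: adjoint_map_square_form.
exact: lin_span_right_form.
Qed.
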